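(* Let $l<k$ be positive integers, let $A,B_1,\dots,B_k$ be finite sets in a commutative group with $A$ nonempty, $K=\{1,\dots,k\}$, $B_I=\sum_{i\in I}B_i$, $|A|=m$, $|A+B_I|=\alpha_Im$, and $\beta=\bigl(\prod_{L\subseteq K,|L|=l}\alpha_L\bigr)^{(l-1)!(k-l)!/(k-1)!}$. (a) For every integer $a$ with $1\le a\le m$ there exists $X\subseteq A$ with $|X|\ge a$ such that $$|X+B_K|\le \beta m^{k/l}\Bigl(m^{-k/l}+(m-1)^{-k/l}+\dots+(m-a+1)^{-k/l}+(|X|-a)(m-a+1)^{-k/l}\Bigr).$$ (b) For every real $t$ with $0\le t<m$ there exists $X\subseteq A$ with $|X|>t$ such that $$|X+B_K|\le \beta m^{k/l}\Bigl(\frac{l}{k-l}\bigl((m-t)^{1-k/l}-m^{1-k/l}\bigr)+(|X|-t)(m-t)^{-k/l}\Bigr).$$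
   Context: Sumsets are $X+Y=\{x+y:x\in X,y\in Y\}$. *)

(* Defs.v *)
From HB Require Import structures.
From mathcomp Require Import all_boot all_order all_algebra.
From mathcomp Require Import finmap.
From mathcomp Require Import reals exp.
Set Implicit Arguments. Unset Strict Implicit. Unset Printing Implicit Defensive.
Import Order.TTheory GRing.Theory Num.Theory.

Local Open Scope fset_scope.

Definition sumset (G : zmodType) (X Y : {fset G}) : {fset G} :=
  [fset (x + y)%R | x in X, y in Y].

Definition sumB (G : zmodType) (k : nat) (B : 'I_k -> {fset G}) (I : {set 'I_k})
  : {fset G} := \big[@sumset G/[fset 0%R]]_(i in I) B i.

(* Main.v *)
(* Entropy proof of Plünnecke's inequality for different summands. Suppose that
   |X + B_K| >= D |X| for all X in A, with equality for some nonempty X. By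
   Hall's theorem there are random x in A, uniform, and y_i in B_i such that no
   value of x + y_1 + ... + y_k has probability above 1 / (D m). Among the joint
   laws with these constraints take one of (nearly) maximal entropy. Given
   U_I = x + sum_(i in I) y_i, making (x, y_i for i in I) and (y_i for i not in I)
   conditionally independent preserves the constraints and does not decrease the
   entropy, so they already are (nearly) independent given U_I. This makes
   I |-> H(U_I) submodular, and Han's inequality together with
   H(U_L) <= ln |A + B_L| and H(U_K) >= ln (D m) gives D <= beta.
   Large sets X are then collected by applying this repeatedly to the rest of A. *)

Require Import Defs.
From HB Require Import structures.
From mathcomp Require Import all_boot all_order all_algebra.
From mathcomp Require Import finmap.
From mathcomp Require Import reals exp.
From mathcomp Require Import zify ring lra.
Set Implicit Arguments. Unset Strict Implicit. Unset Printing Implicit Defensive.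
Import Order.TTheory GRing.Theory Num.Theory.
Local Open Scope ring_scope.

(** * Hall's marriage theorem *)

Section Hall.
Variables T U : finType.
Implicit Types (N : T -> {set U}) (X Y : {set T}).

(* Rado's argument: if removing [y1] and removing [y2] violate Hall's condition at
   [X1] and [X2], then it fails for [N] at [X1 :|: X2] or at [X1 :&: X2 :\ x]. *)
Lemma hall_shrink N : (forall X, #|X| <= #|\bigcup_(x in X) N x|)%N ->
  forall x y1 y2, y1 \in N x -> y2 \in N x -> y1 != y2 ->
  exists2 y, y \in N x & forall X,
    (#|X| <= #|\bigcup_(z in X) (if z == x then N x :\ y else N z)|)%N.
Proof.
move=> hallN x y1 y2 y1N y2N y12.
pose N' y z := if z == x then N x :\ y else N z.
have cupx y X : x \in X ->
    \bigcup_(z in X) N' y z = (N x :\ y) :|: \bigcup_(z in X :\ x) N z.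
  move=> xX; rewrite (bigD1 x) //= {1}/N' eqxx; congr (_ :|: _).
  apply: eq_big => z; first by rewrite !inE andbC.
  by move=> /andP[_ /negPf zx]; rewrite /N' zx.
have cupNx y X : x \notin X -> \bigcup_(z in X) N' y z = \bigcup_(z in X) N z.
  move=> xX; apply: eq_bigr => z zX; rewrite /N'.
  by case: eqP => // zx; rewrite -zx zX in xX.
have [/forallP h1|/forallPn[X1 h1]] :=
    boolP [forall X : {set T}, (#|X| <= #|\bigcup_(z in X) N' y1 z|)%N].
  by exists y1.
have [/forallP h2|/forallPn[X2 h2]] :=
    boolP [forall X : {set T}, (#|X| <= #|\bigcup_(z in X) N' y2 z|)%N].
  by exists y2.
exfalso.
have xX1 : x \in X1.
  by apply: contraNT h1 => xX; rewrite cupNx.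
have xX2 : x \in X2.
  by apply: contraNT h2 => xX; rewrite cupNx.
move: h1 h2; rewrite -!ltnNge !cupx //.
set W1 := _ :|: _; set W2 := _ :|: _ => lt1 lt2.
have subU : \bigcup_(z in X1 :|: X2) N z \subset W1 :|: W2.
  apply/bigcupsP => z zX; apply/subsetP => u uz.
  case: (eqVneq z x) uz => [->|zx] uz.
    rewrite !inE uz !andbT; case: (eqVneq u y1) => [->|] //=.
    by rewrite y12 /= orbT.
  rewrite /W1 /W2 !in_setU; case/setUP: zX => zX.
    suff -> : u \in \bigcup_(z0 in X1 :\ x) N z0 by rewrite orbT.
    by apply/bigcupP; exists z; rewrite // !inE zx.
  suff -> : u \in \bigcup_(z0 in X2 :\ x) N z0 by rewrite !orbT.
  by apply/bigcupP; exists z; rewrite // !inE zx.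
have subI : \bigcup_(z in (X1 :&: X2) :\ x) N z \subset W1 :&: W2.
  apply/bigcupsP => z; rewrite !inE => /and3P[zx z1 z2].
  apply/subsetP => u uz; rewrite /W1 /W2 in_setI !in_setU.
  by apply/andP; split; apply/orP; right; apply/bigcupP; exists z; rewrite // !inE zx.
(* [W1] and [W2] together fall short of [X1] and [X2] by at least 2, whereas leaving [x] out of the
   intersection costs only 1. *)
have := leq_add (leq_trans (hallN _) (subset_leq_card subU))
                (leq_trans (hallN _) (subset_leq_card subI)).
have := cardsUI X1 X2; rewrite (cardsD1 x (X1 :&: X2)) !inE xX1 xX2 /=.
by have := cardsUI W1 W2; lia.
Qed.

(** Removing elements one at a time keeps Hall's condition and ends with singletons, where the
    condition on pairs makes the forced choice injective. *)
Lemma hall_marriage N : (forall X, #|X| <= #|\bigcup_(x in X) N x|)%N ->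
  exists2 f : T -> U, injective f & forall x, f x \in N x.
Proof.
have [n] := ubnP (\sum_x #|N x|)%N; elim: n N => // n IHn N ltn hallN.
have N_gt0 x : (0 < #|N x|)%N.
  by have := hallN [set x]; rewrite cards1 big_set1.
have [/forallP N1|/forallPn[x]] := boolP [forall x, #|N x| == 1%N].
  have fP x : exists y, N x == [set y].
    by have /cards1P[y ->] := N1 x; exists y.
  exists (fun x => xchoose (fP x)); last first.
    by move=> x; rewrite [in X in _ \in X](eqP (xchooseP (fP x))) set11.
  move=> x y exy; apply/eqP; apply: contraT => xy.
  have := hallN [set x; y]; rewrite cards2 xy.
  have Nx := eqP (xchooseP (fP x)); have Ny := eqP (xchooseP (fP y)).
  by rewrite big_setU1 ?inE //= big_set1 Nx [N y]Ny exy setUid cards1.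
rewrite eqn_leq N_gt0 andbT -ltnNge => /card_gt1P[y1 [y2 [y1N y2N y12]]].
have [y yN hallN'] := hall_shrink hallN y1N y2N y12.
have [|f f_inj fN] := IHn _ _ hallN'.
  rewrite -ltnS; apply: leq_trans ltn; rewrite ltnS (bigD1 x) //= eqxx [X in (_ < X)%N](bigD1 x) //=.
  rewrite (cardsD1 y (N x)) yN add1n addSn ltnS leq_add2l.
  by apply: leq_sum => z /negPf ->.
by exists f => // z; have := fN z; case: eqP => // ->; rewrite inE => /andP[].
Qed.

End Hall.

(** * Shannon entropy on a finite probability space *)

Section Entropy.
Variables (R : realType) (Om : finType).
Implicit Types (p : Om -> R).

Definition law p := (forall w, 0 <= p w) /\ \sum_w p w = 1.

(** The distribution of [f], indexed by sample points instead of values: [f] may then land in any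
    [eqType], and Shannon entropy becomes an expectation over [Om]. *)
Definition mass p (T : eqType) (f : Om -> T) (w : Om) : R :=
  \sum_(w' | f w' == f w) p w'.

Definition entropy p (T : eqType) (f : Om -> T) : R :=
  - \sum_w p w * ln (mass p f w).

Lemma mass_ge0 p (T : eqType) (f : Om -> T) w : law p -> 0 <= mass p f w.
Proof. by case=> p0 _; apply: sumr_ge0. Qed.

Lemma le_mass p (T : eqType) (f : Om -> T) w : law p -> p w <= mass p f w.
Proof.
by case=> p0 _; rewrite /mass (bigD1 w) //= lerDl; apply: sumr_ge0.
Qed.

Lemma mass_gt0 p (T : eqType) (f : Om -> T) w :
  law p -> p w != 0 -> 0 < mass p f w.
Proof.
by move=> lp pw; apply: lt_le_trans (le_mass f w lp); rewrite lt_def pw lp.1.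
Qed.

Lemma mass_class p (T : eqType) (f : Om -> T) w w' :
  f w = f w' -> mass p f w = mass p f w'.
Proof. by move=> e; rewrite /mass e. Qed.

(** The hypotheses make [P] empty or a single fibre of [f], on which the terms are conditional
    probabilities. On a null fibre the sum is 0, since division by 0 gives 0. *)
Lemma sum_class_le1 p (T : eqType) (f : Om -> T) (P : pred Om) :
  law p -> (forall w w', P w -> P w' -> f w = f w') ->
  (forall w w', P w -> f w' = f w -> P w') ->
  \sum_(w | P w) p w / mass p f w <= 1.
Proof.
move=> lp Pf fP; case: (pickP P) => [w0 Pw0|P0]; last by rewrite big_pred0.
have PE w : P w = (f w == f w0).
  by apply/idP/eqP => [Pw|/fP->//]; apply: Pf.
have -> : \sum_(w | P w) p w / mass p f w = mass p f w0 / mass p f w0.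
  rewrite [X in _ = X / _]/mass mulr_suml.
  by apply: eq_big => // w; rewrite PE => /eqP fw; rewrite (mass_class p fw).
by case: (eqVneq (mass p f w0) 0) => [->|m0]; rewrite ?mul0r ?ler01 ?divff.
Qed.

(* Gibbs' inequality for the subprobability of density [q] with respect to [p]. *)
Lemma gibbs p (q : Om -> R) : law p -> (forall w, p w != 0 -> 0 < q w) ->
  \sum_w p w * q w <= 1 -> \sum_w p w * ln (q w) <= 0.
Proof.
move=> lp q0 q1; apply: (@le_trans _ _ (\sum_w p w * (q w - 1))).
  apply: ler_sum => w _; case: (eqVneq (p w) 0) => [->|pw]; first by rewrite !mul0r.
  rewrite ler_wpM2l ?lp.1 //.
  have -> : q w = 1 + (q w - 1) by ring.
  by rewrite (le_trans (le_ln1Dx _)) //; have := q0 _ pw; lra.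
under eq_bigr do rewrite mulrBr mulr1.
by rewrite sumrB lp.2; lra.
Qed.

(** Nonnegativity of the conditional mutual information of [f] and [g] given [h], with [j] standing
    for the pair: Gibbs' inequality for the density of the conditionally independent coupling. *)
Lemma entropy_submodular p (T1 T2 T3 T4 : eqType) (f : Om -> T1) (g : Om -> T2)
    (h : Om -> T3) (j : Om -> T4) : law p ->
  (forall w w', j w = j w' <-> f w = f w' /\ g w = g w') ->
  (forall w w', f w = f w' -> h w = h w') ->
  (forall w w', g w = g w' -> h w = h w') ->
  entropy p j + entropy p h <= entropy p f + entropy p g.
Proof.
move=> lp jP fh gh.
have jE w w' : (j w == j w') = (f w == f w') && (g w == g w').
  apply/eqP/andP => [/jP[-> ->]//|[/eqP fe /eqP ge]]; exact/jP.
pose q w := mass p f w * mass p g w / (mass p j w * mass p h w).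
rewrite /entropy -subr_le0.
have -> : - (\sum_w p w * ln (mass p j w)) - \sum_w p w * ln (mass p h w) -
   (- (\sum_w p w * ln (mass p f w)) - \sum_w p w * ln (mass p g w)) =
   \sum_w p w * ln (q w).
  transitivity (\sum_w (p w * ln (mass p f w) + p w * ln (mass p g w) -
     (p w * ln (mass p j w) + p w * ln (mass p h w)))).
    by rewrite sumrB !big_split /=; ring.
  apply: eq_bigr => w _; case: (eqVneq (p w) 0) => [->|pw]; first by rewrite !mul0r; ring.
  have m0 (S : eqType) (z : Om -> S) : mass p z w \is Num.pos by rewrite posrE mass_gt0.
  by rewrite /q ln_div ?lnM ?rpredM //; ring.
apply: gibbs => // [w pw|]; first by rewrite /q divr_gt0 // mulr_gt0 // mass_gt0.
(* Expanding the numerator's masses gives a sum over pairs in a common fibre of [h]; each inner sum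
   runs over at most one fibre of [j]. *)
have -> : \sum_w p w * q w = \sum_w1 \sum_(w2 | h w2 == h w1)
   p w1 * p w2 / mass p h w1 * \sum_(w | (f w == f w1) && (g w == g w2)) p w / mass p j w.
  transitivity (\sum_w \sum_(w1 | f w1 == f w) \sum_(w2 | g w2 == g w)
      p w1 * p w2 * (p w / mass p j w) / mass p h w).
    apply: eq_bigr => w _; rewrite /q.
    under [RHS]eq_bigr do rewrite -mulr_suml -mulr_suml -mulr_sumr.
    by rewrite -!mulr_suml -/(mass p f w) -/(mass p g w) invfM; ring.
  rewrite (exchange_big_dep predT) //=; apply: eq_bigr => w1 _.
  rewrite (exchange_big_dep (fun w2 => h w2 == h w1)) /=; last first.
    by move=> w w2 /eqP/fh -> /eqP/gh ->.
  apply: eq_bigr => w2 _; rewrite mulr_sumr; apply: eq_big => w.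
    by rewrite [f w == _]eq_sym [g w == _]eq_sym.
  by move=> /andP[/eqP/fh e _]; rewrite (mass_class p e); ring.
apply: (@le_trans _ _ (\sum_w1 p w1)); last by rewrite lp.2.
apply: ler_sum => w1 _.
apply: (@le_trans _ _ (\sum_(w2 | h w2 == h w1) p w1 * p w2 / mass p h w1)).
  apply: ler_sum => w2 _; apply: ler_piMr.
    by rewrite divr_ge0 ?mass_ge0 // mulr_ge0 ?lp.1.
  apply: sum_class_le1 => // w w'.
    by move=> /andP[/eqP fw /eqP gw] /andP[/eqP fw' /eqP gw']; apply/eqP; rewrite jE fw fw' gw gw' !eqxx.
  by move=> /andP[/eqP <- /eqP <-] /eqP; rewrite jE.
rewrite -mulr_suml -mulr_sumr -/(mass p h w1).
case: (eqVneq (mass p h w1) 0) => [->|m0]; first by rewrite mulr0 mul0r lp.1.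
by rewrite mulfK.
Qed.

(** Gibbs' inequality against the uniform law on [S]. *)
Lemma entropy_le_ln_card p (T : choiceType) (f : Om -> T) (S : {fset T}) :
  law p -> (forall w, f w \in S) -> entropy p f <= ln (#|` S|%:R).
Proof.
move=> lp fS.
have S0 : (0 : R) < #|` S|%:R.
  rewrite ltr0n lt0n; apply: contra_eqN lp.2 => /eqP S0.
  rewrite big1 => [|w _]; first by rewrite eq_sym oner_eq0.
  by move: (fS w); rewrite (cardfs0_eq S0) inE.
rewrite -subr_le0 /entropy.
have -> : - (\sum_w p w * ln (mass p f w)) - ln #|` S|%:R =
   \sum_w p w * ln ((#|` S|%:R * mass p f w)^-1).
  transitivity (\sum_w (- (p w * ln (mass p f w)) - p w * ln (#|` S|%:R))).
    by rewrite sumrB sumrN -mulr_suml lp.2 mul1r.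
  apply: eq_bigr => w _; case: (eqVneq (p w) 0) => [->|pw]; first by rewrite !mul0r; ring.
  have m0 : 0 < mass p f w by rewrite mass_gt0.
  by rewrite lnV ?posrE ?mulr_gt0 // lnM ?posrE //; ring.
apply: gibbs => // [w pw|]; first by rewrite invr_gt0 mulr_gt0 // mass_gt0.
have -> : \sum_w p w / (#|` S|%:R * mass p f w) =
   #|` S|%:R^-1 * \sum_(s : S) \sum_(w | f w == val s) p w / mass p f w.
  rewrite mulr_sumr; under [RHS]eq_bigr do rewrite mulr_sumr.
  rewrite (exchange_big_dep predT) //=; apply: eq_bigr => w _.
  rewrite (big_pred1 [` fS w]%fset) => [|s]; last first.
    by rewrite /= -val_eqE /= eq_sym.
  by rewrite invfM; ring.
rewrite mulrC ler_pdivrMr // mul1r cardfE -sum1_card natr_sum.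
apply: ler_sum => s _; apply: sum_class_le1 => // w w'; first by move=> /eqP-> /eqP->.
by move=> /eqP<- ->.
Qed.

Lemma ln_le_entropy p (T : eqType) (f : Om -> T) (c : R) : law p -> 0 < c ->
  (forall w, mass p f w <= c^-1) -> ln c <= entropy p f.
Proof.
move=> lp c0 le_c; rewrite /entropy lerNr -[- ln c]mul1r -lp.2 mulr_suml.
apply: ler_sum => w _; case: (eqVneq (p w) 0) => [->|pw]; first by rewrite !mul0r.
rewrite ler_wpM2l ?lp.1 // -lnV ?posrE //.
by rewrite ler_ln ?posrE ?invr_gt0 // mass_gt0.
Qed.

Lemma entropy_uniform p (T : eqType) (f : Om -> T) (c : R) : law p -> 0 < c ->
  (forall w, mass p f w = c^-1) -> entropy p f = ln c.
Proof.
move=> lp c0 eq_c; rewrite /entropy; under eq_bigr do rewrite eq_c.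
by rewrite -mulr_suml lp.2 mul1r lnV ?posrE // opprK.
Qed.

Lemma mass_indicator p (T : eqType) (f : Om -> T) w :
  mass p f w = \sum_w' p w' * (f w' == f w)%:R.
Proof.
rewrite /mass big_mkcond; apply: eq_bigr => w' _.
by case: eqP => _; rewrite ?mulr1 ?mulr0.
Qed.

(* When [a] and [b] together encode a point and [u] is a function of each of
   them, this is the law under which [a] and [b] keep their distributions but
   are independent conditionally on [u]. *)
Definition glue p (Ta Tb Tu : eqType) (a : Om -> Ta) (b : Om -> Tb)
  (u : Om -> Tu) (w : Om) : R := mass p a w * mass p b w / mass p u w.

Lemma glueC p (Ta Tb Tu : eqType) (a : Om -> Ta) (b : Om -> Tb) (u : Om -> Tu) w :
  glue p a b u w = glue p b a u w.
Proof. by rewrite /glue [X in X / _]mulrC. Qed.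

(** When [u w = u w'], [c w w'] is the only point combining the [a] of [w] with the [b] of [w'].
    Sampling from [glue] thus means drawing [w1] from [p], then [w2] from [p] given [u w1], and
    combining them; [F] sees only [w1]. *)
Lemma glue_margin p (Ta Tb Tu : eqType) (a : Om -> Ta) (b : Om -> Tb)
    (u : Om -> Tu) (c : Om -> Om -> Om) (F : Om -> R) : law p ->
  (forall w w', a w = a w' -> u w = u w') ->
  (forall w w', b w = b w' -> u w = u w') ->
  (forall w w', a w = a w' -> b w = b w' -> w = w') ->
  (forall w w', u w = u w' -> a (c w w') = a w /\ b (c w w') = b w') ->
  (forall w w', a w = a w' -> F w = F w') ->
  \sum_w glue p a b u w * F w = \sum_w p w * F w.
Proof.
move=> lp au bu ab_inj cP aF.
transitivity (\sum_w1 \sum_(w2 | u w2 == u w1)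
   \sum_(w | (a w == a w1) && (b w == b w2)) p w1 * p w2 / mass p u w1 * F w1).
  transitivity (\sum_w \sum_(w1 | a w1 == a w) \sum_(w2 | b w2 == b w)
      p w1 * p w2 / mass p u w * F w).
    apply: eq_bigr => w _; rewrite /glue.
    under [RHS]eq_bigr do rewrite -mulr_suml -mulr_suml -mulr_sumr.
    by rewrite -!mulr_suml.
  rewrite (exchange_big_dep predT) //=; apply: eq_bigr => w1 _.
  rewrite (exchange_big_dep (fun w2 => u w2 == u w1)) /=; last first.
    by move=> w w2 /eqP/au -> /eqP/bu ->.
  apply: eq_bigr => w2 _; apply: eq_big => w.
    by rewrite [a w == _]eq_sym [b w == _]eq_sym.
  by move=> /andP[/eqP e _]; rewrite (mass_class p (au _ _ e)) (aF _ _ e).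
apply: eq_bigr => w1 _.
transitivity (\sum_(w2 | u w2 == u w1) p w1 * p w2 / mass p u w1 * F w1).
  apply: eq_bigr => w2 /eqP uw; have [ca cb] := cP _ _ (esym uw).
  rewrite (big_pred1 (c w1 w2)) // => w /=; apply/andP/eqP => [[/eqP e1 /eqP e2]|->].
    by apply: ab_inj; rewrite ?ca ?cb.
  by rewrite ca cb !eqxx.
rewrite -!mulr_suml -mulr_sumr -/(mass p u w1).
case: (eqVneq (p w1) 0) => [->|pw]; first by rewrite !mul0r.
by rewrite mulfK // gt_eqF // mass_gt0.
Qed.

Lemma law_glue p (Ta Tb Tu : eqType) (a : Om -> Ta) (b : Om -> Tb)
    (u : Om -> Tu) (c : Om -> Om -> Om) : law p ->
  (forall w w', a w = a w' -> u w = u w') ->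
  (forall w w', b w = b w' -> u w = u w') ->
  (forall w w', a w = a w' -> b w = b w' -> w = w') ->
  (forall w w', u w = u w' -> a (c w w') = a w /\ b (c w w') = b w') ->
  law (glue p a b u).
Proof.
move=> lp au bu ab_inj cP; split=> [w|].
  by rewrite divr_ge0 ?mulr_ge0 ?mass_ge0.
have := @glue_margin _ _ _ _ a b u c (fun=> 1) lp au bu ab_inj cP (fun _ _ _ => erefl).
by under eq_bigr do rewrite mulr1; under [in RHS]eq_bigr do rewrite mulr1; rewrite lp.2.
Qed.

(** The logarithm of [glue] splits into terms depending on [a], [b] and [u], whose expectations are
    the same under [glue] as under [p]. *)
Lemma entropy_glue p (Ta Tb Tu : eqType) (a : Om -> Ta) (b : Om -> Tb)
    (u : Om -> Tu) (c : Om -> Om -> Om) : law p ->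
  (forall w w', a w = a w' -> u w = u w') ->
  (forall w w', b w = b w' -> u w = u w') ->
  (forall w w', a w = a w' -> b w = b w' -> w = w') ->
  (forall w w', u w = u w' -> a (c w w') = a w /\ b (c w w') = b w') ->
  entropy (glue p a b u) id = entropy p a + entropy p b - entropy p u.
Proof.
move=> lp au bu ab_inj cP; set q := glue p a b u.
have qa F : (forall w w', a w = a w' -> F w = F w') ->
    \sum_w q w * F w = \sum_w p w * F w.
  exact: glue_margin lp au bu ab_inj cP.
have qb F : (forall w w', b w = b w' -> F w = F w') ->
    \sum_w q w * F w = \sum_w p w * F w.
  move=> bF; under eq_bigr do rewrite /q glueC.
  apply: (@glue_margin _ _ _ _ b a u (fun w w' => c w' w)) => // [w w' eb ea|w w' uw].
    exact: ab_inj.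
  by have [] := cP _ _ (esym uw).
rewrite /entropy -(qa (fun w => ln (mass p a w))); last by move=> w w' /(mass_class p) ->.
rewrite -(qb (fun w => ln (mass p b w))); last by move=> w w' /(mass_class p) ->.
rewrite -(qa (fun w => ln (mass p u w))); last by move=> w w' /au/(mass_class p) ->.
rewrite -!sumrN -!big_split /=; apply: eq_bigr => w _.
have -> : mass q id w = q w by rewrite /mass big_pred1_eq.
case: (eqVneq (q w) 0) => [->|]; first by rewrite !mul0r; ring.
rewrite {1}/q /glue !mulf_eq0 invr_eq0 !negb_or => /andP[/andP[a0 b0] u0].
have m0 (S : eqType) (z : Om -> S) : mass p z w != 0 -> mass p z w \is Num.pos.
  by move=> z0; rewrite posrE lt_def z0 mass_ge0.
by rewrite {2}/q /glue ln_div ?lnM ?rpredM ?m0 //; ring.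
Qed.

(** Entropy is bounded by [ln] of the size of [Om], so a supremum exists; coming within [eps] of it
    avoids a compactness argument. *)
Lemma near_max_entropy (P : (Om -> R) -> Prop) (eps : R) : 0 < eps ->
  (forall p, P p -> law p) -> (exists p, P p) ->
  exists2 p, P p & forall q, P q -> entropy q id <= entropy p id + eps.
Proof.
move=> eps0 Plaw [p0 Pp0].
pose E : classical_sets.set R := fun x => exists2 p, P p & x = entropy p id.
have supE : classical_sets.has_sup E.
  split; first by exists (entropy p0 id), p0.
  exists (ln (#|` [fset w in enum Om]%fset|%:R)) => _ [p Pp ->].
  by apply: entropy_le_ln_card => [|w]; [exact: Plaw|rewrite !inE mem_enum].
have [_ [p Pp ->] ltp] := sup_adherent eps0 supE.
exists p => // q Pq; rewrite -lerBlDr.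
have : entropy q id <= sup E by apply: sup_upper_bound => //; exists q.
by lra.
Qed.

End Entropy.

(** * Entropies of the partial sums of the random summands *)

Section PartialSums.
Variables (R : realType) (G : zmodType) (k : nat).
Variables (A : {fset G}) (B : 'I_k -> {fset G}).
Local Notation Om := (A * {dffun forall i : 'I_k, B i})%type.
Implicit Types (p : Om -> R) (w : Om) (I J M : {set 'I_k}).

Definition psum I w : G := val w.1 + \sum_(i in I) val (w.2 i).
Definition summand (i : 'I_k) w : G := val (w.2 i).
Definition summands I w : {ffun 'I_k -> G} :=
  [ffun i => if i \in I then val (w.2 i) else 0].
Definition past M w := (w.1, summands M w).
(** Including [psum M] makes every [psum J] with [M \subset J] a function of [future M]. Past and
    future share [psum M] and together determine the sample point. *)
Definition future M w := (psum M w, summands (~: M) w).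
Definition splice M w w' : Om :=
  (w.1, [ffun i => if i \in M then w.2 i else w'.2 i]).

Lemma summandsP I w w' :
  summands I w = summands I w' <-> forall i, i \in I -> summand i w = summand i w'.
Proof.
split=> [e i iI|e]; first by move/ffunP: e => /(_ i); rewrite !ffunE iI.
by apply/ffunP => i; rewrite !ffunE; case: ifP => // /e.
Qed.

Lemma psum0 w : psum set0 w = val w.1.
Proof. by rewrite /psum big_set0 addr0. Qed.

Lemma psumU1 I i w : i \notin I -> psum (i |: I) w = psum I w + summand i w.
Proof. by move=> iI; rewrite /psum big_setU1 //= -addrA [val (w.2 i) + _]addrC. Qed.

Lemma psum_past I M w w' : I \subset M -> past M w = past M w' -> psum I w = psum I w'.
Proof.
move=> /subsetP sIM [e1 /summandsP e2]; rewrite /psum e1; congr (_ + _).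
by apply: eq_bigr => i /sIM/e2.
Qed.

Lemma summand_past M i w w' : i \in M -> past M w = past M w' -> summand i w = summand i w'.
Proof. by move=> iM [_ /summandsP->]. Qed.

Lemma psum_future M J w w' :
  M \subset J -> future M w = future M w' -> psum J w = psum J w'.
Proof.
move=> sMJ [e1 /summandsP e2].
have psumE v : psum J v = psum M v + \sum_(i in J :\: M) val (v.2 i).
  by rewrite /psum (big_setID M) /= (setIidPr sMJ) addrA.
rewrite !psumE e1; congr (_ + _); apply: eq_bigr => i.
by rewrite inE => /andP[iM _]; apply: e2; rewrite inE.
Qed.

Lemma past_future_inj M w w' : past M w = past M w' -> future M w = future M w' -> w = w'.
Proof.
move=> [e1 /summandsP e2] [_ /summandsP e3]; case: w w' e1 e2 e3 => [x y] [x' y'] /= -> e2 e3.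
congr (_, _); apply/ffunP => i; apply: val_inj.
by case: (boolP (i \in M)) => iM; [apply: e2|apply: e3; rewrite inE].
Qed.

Lemma past_splice M w w' : past M (splice M w w') = past M w.
Proof.
by congr (_, _); apply/summandsP => i iM; rewrite /summand /= ffunE iM.
Qed.

Lemma future_splice M w w' :
  psum M w = psum M w' -> future M (splice M w w') = future M w'.
Proof.
move=> e; congr (_, _); first by rewrite -e; apply: (@psum_past M M) => //; exact: past_splice.
by apply/summandsP => i; rewrite inE /summand /= ffunE => /negPf ->.
Qed.

(* The hypothesis on [past] and [future] says that their conditional mutual
   information given [psum M] is at most [eta]. With U = psum, the claim is the sum of H(y_i | U_J) <= H(y_i | U_I) + eta and
   H(y_i | U_(I+i)) <= H(y_i | U_(J+i)) + eta. *)
Lemma near_submodular_step p (eta : R) I J i : law p ->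
  (forall M, entropy p (past M) + entropy p (future M) - entropy p (psum M)
             <= entropy p id + eta) ->
  I \subset J -> i \notin J ->
  entropy p (psum (i |: J)) - entropy p (psum J) <=
  entropy p (psum (i |: I)) - entropy p (psum I) + 2 * eta.
Proof.
move=> lp markov sIJ iJ.
have iI : i \notin I by apply: contra iJ; apply: subsetP.
pose q S w := (psum S w, summand i w).
have addI (S : {set 'I_k}) (w w' : Om) : i \notin S -> psum (i |: S) w = psum (i |: S) w' ->
    summand i w = summand i w' -> psum S w = psum S w'.
  by move=> iS; rewrite !psumU1 // => e e'; move: e; rewrite e' => /addIr.
have m1 := markov J; have m2 := markov (i |: I).
(* [s1], [s2] and [m1] bound H(y_i | U_J): given U_J, the past of [J] says almost nothing about y_i,
   and this past determines U_I. *)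
have s1 : entropy p id + entropy p (q J) <=
    entropy p (future J) + entropy p (fun w => (past J w, summand i w)).
  apply: entropy_submodular => // w w'.
  - by split=> [->//|[e2 /(congr1 fst) e1]]; apply: past_future_inj e1 e2.
  - move=> e; rewrite /q (psum_future _ e) //; congr (_, _).
    by case: e => _ /summandsP -> //; rewrite inE.
  - move=> e; rewrite /q (psum_past _ (congr1 fst e)) //.
    by congr (_, _); exact: (congr1 snd e).
have s2 : entropy p (fun w => (past J w, summand i w)) + entropy p (psum I) <=
    entropy p (past J) + entropy p (q I).
  apply: entropy_submodular => // w w'.
  - split=> [e|[e /(congr1 snd) e']]; last by congr (_, _).
    split; first exact: (congr1 fst e).
    rewrite /q (psum_past _ (congr1 fst e)) //; congr (_, _); exact: (congr1 snd e).
  - exact: psum_past.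
  - by case.
(* [s3], [s4] and [m2] bound H(y_i | U_(I+i)) through the future of I+i, which determines U_(J+i).
   Here [q I] and (U_(I+i), y_i) determine each other. *)
have s3 : entropy p id + entropy p (q I) <= entropy p (past (i |: I)) +
    entropy p (fun w => (future (i |: I) w, summand i w)).
  apply: entropy_submodular => // w w'.
  - by split=> [->//|[e1 /(congr1 fst) e2]]; apply: past_future_inj e1 e2.
  - move=> e; rewrite /q (psum_past _ e) ?subsetUr //.
    by rewrite (summand_past _ e) ?setU11.
  - move=> e; have e1 := congr1 (fst \o fst) e; have e2 := congr1 snd e.
    by rewrite /q (addI I _ _ iI e1 e2); congr (_, _).
have s4 : entropy p (fun w => (future (i |: I) w, summand i w)) +
    entropy p (psum (i |: J)) <= entropy p (future (i |: I)) + entropy p (q J).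
  apply: entropy_submodular => // w w'.
  - split=> [e|[e /(congr1 snd) e']]; last by congr (_, _).
    have e1 := congr1 fst e; have e2 := congr1 snd e; split=> //.
    congr (_, _) => //; apply: addI => //.
    by apply: psum_future e1; apply: setUS.
  - by apply: psum_future; apply: setUS.
  - by move=> [e e']; rewrite !psumU1 // e e'.
lra.
Qed.

End PartialSums.

(** * Han's inequality for nearly submodular set functions *)

Lemma card_draws_mem (k l : nat) (i : 'I_k) : (0 < l)%N ->
  #|[set L : {set 'I_k} | (#|L| == l) && (i \in L)]| = 'C(k.-1, l.-1).
Proof.
case: l => // l _; case: k i => [[]//|k] i /=.
(* Subsets avoiding [i] are the subsets of its complement; Pascal's rule leaves the wanted count. *)
have := cardsID [set L : {set 'I_k.+1} | i \in L] [set L : {set 'I_k.+1} | #|L| == l.+1].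
rewrite card_draws card_ord binS addnC.
have -> : [set L : {set 'I_k.+1} | #|L| == l.+1] :\: [set L : {set 'I_k.+1} | i \in L] =
   [set L : {set 'I_k.+1} | (L \subset [set~ i]) && (#|L| == l.+1)].
  by apply/setP => L; rewrite !inE subsetC sub1set inE.
rewrite cards_draws cardsC1 card_ord /= => /addnI <-.
by apply: eq_card => L; rewrite !inE.
Qed.

(* Each [g L - g set0] telescopes along the initial segments of ['I_k]. *)
Lemma near_submodular_han (R : realType) (k l : nat) (g : {set 'I_k} -> R) (eta : R) :
  (forall (I J : {set 'I_k}) i, I \subset J -> i \notin J ->
     g (i |: J) - g J <= g (i |: I) - g I + eta) ->
  (0 < l)%N ->
  'C(k.-1, l.-1)%:R * (g setT - g set0) <=
  \sum_(L : {set 'I_k} | #|L| == l) (g L - g set0 + l%:R * eta).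
Proof.
move=> sub l0; pose pre n : {set 'I_k} := [set j : 'I_k | (j < n)%N].
have preS (i : 'I_k) : pre i.+1 = i |: pre i.
  by apply/setP => j; rewrite !inE ltnS leq_eqVlt.
have chain (L : {set 'I_k}) : g L - g set0 =
    \sum_(i < k) (g (L :&: pre i.+1) - g (L :&: pre i)).
  rewrite -(big_mkord predT (fun n => g (L :&: pre n.+1) - g (L :&: pre n))).
  rewrite telescope_sumr //; congr (g _ - g _); apply/setP => j; rewrite !inE ?ltn_ord ?andbT //.
  by rewrite ltn0 andbF.
pose d (i : 'I_k) := g (pre i.+1) - g (pre i).
(* Submodularity compares increments along [L :&: pre i] with those along [pre i]; indices outside
   [L] contribute 0, and the [l] others cost [eta] each. *)
have le_chain (L : {set 'I_k}) : #|L| == l ->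
    \sum_(i in L) d i <= g L - g set0 + l%:R * eta.
  move=> /eqP Ll; rewrite chain.
  have -> : l%:R * eta = \sum_(i in L) eta by rewrite sumr_const Ll mulr_natl.
  rewrite [X in _ <= X + _](bigID [in L]) /= addrAC -big_split /=.
  rewrite [X in _ <= _ + X]big1 => [|i iL]; last first.
    rewrite preS; apply/eqP; rewrite subr_eq0; apply/eqP; congr g; apply/setP => j.
    by rewrite !inE; case: eqP => [->|//]; rewrite (negPf iL).
  rewrite addr0; apply: ler_sum => i iL; rewrite /d preS.
  have -> : L :&: (i |: pre i) = i |: (L :&: pre i).
    by apply/setP => j; rewrite !inE; case: eqP => [->|//]; rewrite iL.
  by apply: sub; [exact: subsetIr|rewrite inE ltnn].
apply: le_trans (ler_sum _ le_chain).
(* Each [i] lies in C(k-1, l-1) sets of size [l], so the [d i] add up to a multiple of the full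
   telescoping sum. *)
rewrite (exchange_big_dep predT) //= -[setT]setTI chain.
rewrite mulr_sumr; apply: ler_sum => i _; rewrite !setTI -/(d i).
by rewrite sumr_const -(card_draws_mem i l0) cardsE mulr_natl.
Qed.

(** * Elements of sumsets *)

Lemma mem_sumset (G : zmodType) (X Y : {fset G}) x y :
  x \in X -> y \in Y -> x + y \in sumset X Y.
Proof. by move=> xX yY; apply/imfset2P; exists x => //; exists y. Qed.

Lemma mem_sumB (G : zmodType) (k : nat) (B : 'I_k -> {fset G}) (I : {set 'I_k})
  (f : 'I_k -> G) : (forall i, f i \in B i) -> \sum_(i in I) f i \in sumB B I.
Proof.
move=> fB; rewrite /sumB.
apply: (big_ind2 (fun (S : {fset G}) s => s \in S)) => [|X x Y y|i _ //].
  by rewrite !inE.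
exact: mem_sumset.
Qed.

Lemma sumBP (G : zmodType) (k : nat) (B : 'I_k -> {fset G}) s :
  s \in sumB B setT ->
  exists y : {dffun forall i : 'I_k, B i}, s = \sum_i val (y i).
Proof.
move=> sB.
suff [f fB ->] : exists2 f : 'I_k -> G, (forall i, f i \in B i) & s = \sum_i f i.
  by exists [ffun i => [` fB i]%fset]; apply: eq_bigr => i _; rewrite ffunE.
(* Membership is asked only on the index list, so that the induction can start from the zero
   function even when some [B i] omits 0. *)
suff [f fB ->] : exists2 f : 'I_k -> G,
    (forall i, i \in index_enum 'I_k -> f i \in B i) & s = \sum_i f i.
  by exists f => // i; apply: fB; rewrite mem_index_enum.
move: sB; rewrite /sumB (eq_bigl predT) => [|i]; last by rewrite inE.
have := index_enum_uniq 'I_k; elim: (index_enum _) s => [|i r IHr] s.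
  by rewrite !big_nil inE => _ /eqP ->; exists (fun=> 0); rewrite ?big_nil.
rewrite /= big_cons => /andP[ir ur] /imfset2P[x xB [t tB ->]].
have [f fB tE] := IHr t ur tB.
exists (fun j => if j == i then x else f j) => [j|].
  by rewrite inE; case: eqP => [->|] //= _ /fB.
rewrite big_cons eqxx tE; congr (_ + _); rewrite big_seq [in RHS]big_seq.
by apply: eq_bigr => j jr; case: eqP => // ji; rewrite -ji jr in ir.
Qed.

(** * The entropy bound for admissible laws *)

Section EntropyBound.
Variables (R : realType) (G : zmodType) (k : nat).
Variables (A : {fset G}) (B : 'I_k -> {fset G}).
Local Notation Om := (A * {dffun forall i : 'I_k, B i})%type.

Definition admissible (c : R) (p : Om -> R) :=
  [/\ law p, forall w, mass p fst w = #|` A|%:R^-1 &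
      forall w, mass p (psum setT) w <= c^-1].

(** [fst] is a function of the past and [psum setT] of the future, and gluing keeps the law of
    each. *)
Lemma admissible_glue c p (M : {set 'I_k}) : admissible c p ->
  admissible c (glue p (past M) (future M) (psum M)).
Proof.
case=> lp pX pS.
have au (w w' : Om) : past M w = past M w' -> psum M w = psum M w'.
  exact: psum_past.
have bu (w w' : Om) : future M w = future M w' -> psum M w = psum M w'.
  exact: psum_future.
have cP (w w' : Om) : psum M w = psum M w' ->
    past M (splice M w w') = past M w /\ future M (splice M w w') = future M w'.
  by move=> e; rewrite past_splice future_splice.
have inj := @past_future_inj _ _ A B M.
split; first exact: law_glue lp au bu inj cP.
- move=> w; rewrite -(pX w) !mass_indicator.
  by apply: glue_margin lp au bu inj cP _ => w1 w2 /(congr1 fst) /= ->.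
- move=> w; rewrite (le_trans _ (pS w)) // !mass_indicator.
  under eq_bigr do rewrite glueC.
  rewrite (@glue_margin _ _ _ _ _ _ _ _ _ (fun w w' => splice M w' w)) //.
  + by move=> w1 w2 e1 e2; apply: inj e2 e1.
  + by move=> w1 w2 e; have [] := cP _ _ (esym e).
  + by move=> w1 w2 /psum_future ->.
Qed.

Lemma entropy_bound (c : R) (p0 : Om -> R) (l : nat) : A != fset0 ->
  admissible c p0 -> 0 < c -> (0 < l)%N ->
  'C(k.-1, l.-1)%:R * (ln c - ln #|` A|%:R) <=
  \sum_(L : {set 'I_k} | #|L| == l)
     (ln #|` sumset A (sumB B L)|%:R - ln #|` A|%:R).
Proof.
move=> A0 adm0 c0 l0; apply/ler_addgt0Pr => e e0.
(* Han's inequality accumulates an error of [2 * N * eta]; the added 1 keeps the denominator of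
   [eta] positive when [N] is 0. *)
pose N : R := (\sum_(L : {set 'I_k} | #|L| == l) l%:R).
have N0 : 0 <= N by apply: sumr_ge0.
pose eta := e / (2 * N + 1).
have eta0 : 0 < eta by rewrite divr_gt0 //; lra.
have [p [lp pX pS] pmax] : exists2 p, admissible c p &
    forall q, admissible c q -> entropy q id <= entropy p id + eta.
  by apply: near_max_entropy => //; [move=> p []|exists p0].
have m0 : (0 : R) < #|` A|%:R by rewrite ltr0n cardfs_gt0.
have markov M : entropy p (past M) + entropy p (future M) - entropy p (psum M)
             <= entropy p id + eta.
  have /pmax := admissible_glue M (And3 lp pX pS).
  rewrite (@entropy_glue _ _ _ _ _ _ _ _ _ (splice M)) //.
  - by move=> w w'; apply: psum_past.
  - by move=> w w'; apply: psum_future.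
  - exact: past_future_inj.
  - by move=> w w' e'; rewrite past_splice future_splice.
have H0 : entropy p (psum set0) = ln #|` A|%:R.
  apply: entropy_uniform => // w; rewrite -(pX w); apply: eq_bigl => w'.
  by rewrite !psum0 (inj_eq val_inj).
have HT : ln c <= entropy p (psum setT) by apply: ln_le_entropy.
have HL (L : {set 'I_k}) : entropy p (psum L) <= ln #|` sumset A (sumB B L)|%:R.
  apply: entropy_le_ln_card => // w; apply: mem_sumset; first exact: valP.
  by apply: mem_sumB => i; exact: valP.
have := near_submodular_han (g := fun I => entropy p (psum I)) _ l0.
move=> /(_ _ (fun I J i => near_submodular_step lp markov)) /= han.
apply: (@le_trans _ _ ('C(k.-1, l.-1)%:R * (entropy p (psum setT) - entropy p (psum set0)))).
  by rewrite ler_wpM2l // H0 lerB.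
apply: (le_trans han); rewrite big_split /= -mulr_suml -/N lerD //.
  by apply: ler_sum => L _; rewrite H0 lerB.
have -> : e = eta * (2 * N + 1) by rewrite /eta divfK // gt_eqF //; lra.
nra.
Qed.

End EntropyBound.

(** * Push-forward of a uniform law *)

Section Pushforward.
Variables (R : realType) (T Om : finType) (W : T -> Om).

Definition pushforward (w : Om) : R := #|[set t | W t == w]|%:R / #|T|%:R.

Lemma mass_pushforward (S : eqType) (f : Om -> S) w :
  mass pushforward f w = #|[set t | f (W t) == f w]|%:R / #|T|%:R.
Proof.
rewrite /mass /pushforward -mulr_suml -natr_sum; congr (_%:R / _).
under eq_bigr do rewrite -sum1dep_card.
rewrite (exchange_big_dep (fun t => f (W t) == f w)) /=.
  rewrite -sum1dep_card; apply: eq_bigr => t ft.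
  rewrite (big_pred1 (W t)) // => w' /=; rewrite [W t == w']eq_sym.
  by case: (eqVneq w' (W t)) => [->|]; rewrite ?ft ?andbF.
by move=> w' t /eqP <- /eqP ->.
Qed.

Lemma law_pushforward : (0 < #|T|)%N -> law pushforward.
Proof.
move=> T0; split=> [w|]; first exact: divr_ge0.
case: (pickP (fun _ : T => true)) => [t0 _|T0']; last by rewrite (eq_card0 T0') in T0.
transitivity (mass pushforward (fun=> 0%N) (W t0)); first exact: eq_bigl.
rewrite mass_pushforward; have -> : [set t | 0%N == 0%N] = [set: T] by apply/setP => t; rewrite !inE.
by rewrite cardsT divff // pnatr_eq0 -lt0n.
Qed.

End Pushforward.

(** * Monotonicity and subadditivity of sumsets in the first summand *)

Lemma sumsetP (G : zmodType) (X Y : {fset G}) s :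
  reflect (exists2 x, x \in X & exists2 y, y \in Y & s = x + y) (s \in sumset X Y).
Proof.
apply: (iffP idP) => [/imfset2P[x xX [y yY ->]]|[x xX [y yY ->]]].
  by exists x => //; exists y.
exact: mem_sumset.
Qed.

Lemma sumsetSl (G : zmodType) (X X' Y : {fset G}) :
  (X `<=` X')%fset -> (sumset X Y `<=` sumset X' Y)%fset.
Proof.
move=> /fsubsetP sXX'; apply/fsubsetP => _ /sumsetP[x /sXX' xX [y yY ->]].
exact: mem_sumset.
Qed.

Lemma sumsetUl (G : zmodType) (X X' Y : {fset G}) :
  (sumset (X `|` X') Y `<=` sumset X Y `|` sumset X' Y)%fset.
Proof.
apply/fsubsetP => _ /sumsetP[x xX [y yY ->]]; rewrite inE.
by case/fsetUP: xX => xX; apply/orP; [left|right]; exact: mem_sumset.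
Qed.

(** * Plunnecke's inequality for one subset *)

Section Plunnecke.
Variables (R : realType) (G : zmodType) (k : nat).
Variables (A : {fset G}) (B : 'I_k -> {fset G}).
Local Notation BK := (sumB B [set: 'I_k]).
Local Notation Om := (A * {dffun forall i : 'I_k, B i})%type.

(* Hall's theorem for [p] copies of each point of [A] and [q] copies of each
   point of [A + B_K]. *)
Lemma exists_admissible (p q : nat) : A != fset0 -> (0 < p)%N -> (0 < q)%N ->
  (forall X : {fset G}, (X `<=` A)%fset -> p * #|` X|%fset <= q * #|` sumset X BK|%fset)%N ->
  exists p0 : Om -> R, admissible (p%:R / q%:R * #|` A|%:R) p0.
Proof.
move=> A0 p_gt0 q_gt0 magn.
pose T := (A * 'I_p)%type; pose U := (sumset A BK * 'I_q)%type.
pose N (t : T) : {set U} := [set u | val u.1 \in sumset [fset val t.1]%fset BK].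
have cardT : #|{: T}| = (#|` A| * p)%N by rewrite card_prod card_ord -cardfE.
have [|f f_inj fN] := @hall_marriage T U N.
  move=> X; pose X' := [fset val t.1 | t in X]%fset.
  have X'A : (X' `<=` A)%fset by apply/fsubsetP => _ /imfsetP[t _ ->]; exact: valP.
  (* [X] has at most [p] copies over each point of [X'], and its neighbourhood contains all [q]
     copies of each point of X' + B_K. *)
  have le1 : (#|X| <= #|` X'| * p)%N.
    rewrite -(card_fsub X'A) -[p in leqRHS]card_ord -cardsT -cardsX.
    apply/subset_leq_card/subsetP => t tX; rewrite !inE andbT.
    by apply/imfsetP; exists t.
  have le2 : (q * #|` sumset X' BK| <= #|\bigcup_(t in X) N t|)%N.
    rewrite mulnC -(card_fsub (sumsetSl BK X'A)) -[q in leqLHS]card_ord -cardsT -cardsX.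
    apply/subset_leq_card/subsetP => -[s j]; rewrite !inE andbT /=.
    move=> /sumsetP[_ /imfsetP[t tX ->] [y yB sE]].
    by apply/bigcupP; exists t => //; rewrite in_set /= sE mem_sumset ?inE.
  by apply: leq_trans le2; apply: leq_trans (magn _ X'A); rewrite mulnC.
(* Each copy of x is matched to a copy of some s in x + B_K, and [W] picks summands of s - x.
   Pushing the uniform law on copies along [W] gives the required law. *)
have /fin_all_exists[W WP] : forall t : T,
    exists w : Om, w.1 = t.1 /\ psum setT w = val (f t).1.
  move=> t; have := fN t; rewrite in_set => /sumsetP[x].
  rewrite inE => /eqP -> [s /sumBP[y ->] fE]; exists (t.1, y); split=> //.
  by rewrite fE /psum; congr (_ + _); apply: eq_bigl => i; rewrite inE.
have m0 : (#|` A| != 0)%N by rewrite cardfs_eq0.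
exists (pushforward R W); split.
- by apply: law_pushforward; rewrite cardT muln_gt0 p_gt0 lt0n m0.
- move=> w; rewrite mass_pushforward cardT.
  have -> : [set t | (W t).1 == w.1] = setX [set w.1] [set: 'I_p].
    by apply/setP => t; rewrite !inE (WP t).1 andbT.
  rewrite cardsX cards1 cardsT card_ord mul1n natrM invfM mulrCA divff ?mulr1 //.
  by rewrite pnatr_eq0 -lt0n.
- move=> w; rewrite mass_pushforward cardT.
  (* Since [f] is injective, copies with the same full sum are matched to different ones of its [q]
     copies. *)
  set S := [set t | _]; have leS : (#|S| <= q)%N.
    rewrite -[q]card_ord -cardsT -(@card_in_imset _ _ (fun t => (f t).2) S).
      by apply: subset_leq_card; apply: subsetT.
    move=> t t'; rewrite !inE !(WP _).2 => /eqP e1 /eqP e1' e2; apply: f_inj.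
    by move: e1 e1' e2; case: (f t) (f t') => [u v] [u' v'] /= <- /val_inj -> ->.
  have -> : (p%:R / q%:R * #|` A|%:R)^-1 = q%:R / (#|` A| * p)%:R :> R.
    by rewrite natrM; field; rewrite !pnatr_eq0 m0 -!lt0n p_gt0 q_gt0.
  by rewrite ler_wpM2r ?invr_ge0 // ler_nat.
Qed.

Lemma min_magnification : A != fset0 ->
  exists X0 : {fset G}, [/\ (X0 `<=` A)%fset, X0 != fset0 &
    forall X, (X `<=` A)%fset ->
      (#|` sumset X0 BK| * #|` X| <= #|` X0| * #|` sumset X BK|)%N].
Proof.
move=> A0; have AA : A \in fpowerset A by rewrite fpowersetE.
(* The empty set must be excluded from the minimisation, as its ratio 0/0 evaluates to 0. *)
pose F (Z : fpowerset A) : rat := #|` sumset (val Z) BK|%:R / #|` val Z|%:R.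
case: (@Order.TotalTheory.arg_minP _ _ _ [` AA]%fset (fun Z => val Z != fset0) F A0) => Z Z0 Zmin.
exists (val Z); split=> // [|X XA]; first by have := valP Z; rewrite fpowersetE.
case: (eqVneq X fset0) => [->|X0]; first by rewrite cardfs0 muln0.
have XP : X \in fpowerset A by rewrite fpowersetE.
have := Zmin [` XP]%fset X0; rewrite /F /= ler_pdivrMr ?ltr0n ?cardfs_gt0 //.
rewrite mulrAC ler_pdivlMr ?ltr0n ?cardfs_gt0 // -!natrM ler_nat.
by rewrite [X in (_ <= X)%N]mulnC.
Qed.

Lemma ln_prod (I : finType) (P : pred I) (F : I -> R) :
  (forall i, P i -> 0 < F i) ->
  0 < \prod_(i | P i) F i /\ ln (\prod_(i | P i) F i) = \sum_(i | P i) ln (F i).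
Proof.
move=> F0; apply: (big_rec2 (fun x y => 0 < x /\ ln x = y)); first by rewrite ltr01 ln1.
move=> i x y /F0 Fi [y0 <-]; split; first exact: mulr_gt0.
by rewrite lnM.
Qed.

Lemma plunnecke (l : nat) : A != fset0 -> (0 < l <= k)%N ->
  exists X : {fset G}, [/\ (X `<=` A)%fset, X != fset0 &
    #|` sumset X BK|%:R <=
      (\prod_(L : {set 'I_k} | #|L| == l) #|` sumset A (sumB B L)|%:R)
        `^ ('C(k.-1, l.-1)%:R^-1) * #|` A|%:R `^ (- (k%:R / l%:R)) * #|` X|%:R :> R].
Proof.
move=> A0 /andP[l0 lk]; have [X [XA X0 Xmin]] := min_magnification A0.
exists X; split=> //; set P := \prod_(L | _) _.
(* The sumset is empty when some [B i] is, and the bound is then trivial; otherwise the logarithms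
   below have positive arguments. *)
have [p0|p_gt0] := posnP #|` sumset X BK|.
  by rewrite p0 mulr_ge0 // mulr_ge0 // powR_ge0.
have q_gt0 : (0 < #|` X|)%N by rewrite cardfs_gt0.
have m0 : (0 : R) < #|` A|%:R by rewrite ltr0n cardfs_gt0.
have X_gt0 : (0 : R) < #|` X|%:R by rewrite ltr0n.
have S_gt0 : (0 : R) < #|` sumset X BK|%:R by rewrite ltr0n.
have pq0 : 0 < #|` sumset X BK|%:R / #|` X|%:R :> R by rewrite divr_gt0.
have AL_gt0 (L : {set 'I_k}) : #|L| == l -> (0 : R) < #|` sumset A (sumB B L)|%:R.
  move=> _; rewrite ltr0n cardfs_gt0; apply/fset0Pn.
  move: p_gt0; rewrite cardfs_gt0 => /fset0Pn[_ /sumsetP[x xX [_ /sumBP[y _] _]]].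
  exists (x + \sum_(i in L) val (y i)); apply: mem_sumset.
    by move/fsubsetP: XA; apply.
  by apply: mem_sumB => i; exact: valP.
have [P0 lnP] := ln_prod AL_gt0.
have C0 : (0 : R) < 'C(k.-1, l.-1)%:R by rewrite ltr0n bin_gt0; lia.
(* Minimality of [X] is the hypothesis for p = |X + B_K| and q = |X|, and the parameter of the law
   becomes |A| times the least ratio. *)
have [p0 adm] := exists_admissible A0 p_gt0 q_gt0 Xmin.
have := entropy_bound A0 adm (mulr_gt0 pq0 m0) l0.
have cardN : #|[pred L : {set 'I_k} | #|L| == l]| = 'C(k, l).
  by rewrite -[in RHS](card_ord k) -card_draws cardsE.
rewrite lnM ?posrE // addrK sumrB -lnP -/P sumr_const cardN => bnd.
(* The ratio C(k, l) / C(k-1, l-1) = k / l produces the exponent of |A|. *)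
have kC : k%:R * 'C(k.-1, l.-1)%:R = l%:R * 'C(k, l)%:R :> R.
  by rewrite -!natrM mul_bin_diag prednK.
have l_gt0 : (0 : R) < l%:R by rewrite ltr0n.
rewrite -ler_pdivrMr // -ler_ln ?posrE ?mulr_gt0 ?powR_gt0 ?invr_gt0 //.
rewrite lnM ?posrE ?powR_gt0 // !ln_powR -(ler_pM2l C0).
apply: le_trans bnd _; rewrite -[ln _ *+ _]mulr_natl mulrDr mulrA divff ?gt_eqF // mul1r.
have -> : 'C(k, l)%:R = k%:R * 'C(k.-1, l.-1)%:R / l%:R :> R.
  by rewrite kC mulrAC divff ?mul1r // gt_eqF.
by rewrite le_eqVlt; apply/predU1P; left; field; rewrite gt_eqF.
Qed.

End Plunnecke.

(** * Collecting large subsets by iteration *)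

Lemma sumset0l (G : zmodType) (Y : {fset G}) : sumset fset0 Y = fset0.
Proof.
apply/eqP; apply: contraT => /fset0Pn[s /sumsetP[x]]; by rewrite inE.
Qed.

Section Iteration.
Variables (R : realType) (G : zmodType) (k l : nat).
Variables (A : {fset G}) (B : 'I_k -> {fset G}).
Hypothesis lk : (0 < l <= k)%N.
Local Notation m := #|` A|%fset.
Local Notation BK := (sumB B [set: 'I_k]).
Local Notation e := (k%:R / l%:R : R).

(** This is beta m^(k/l); without the division by |A|, the product can only decrease when [A]
    shrinks. *)
Definition gamma : R :=
  (\prod_(L : {set 'I_k} | #|L| == l) #|` sumset A (sumB B L)|%:R)
     `^ ('C(k.-1, l.-1)%:R^-1).

(** In Plunnecke's bound for [A'], the sets A' + B_L are enlarged to A + B_L, so one constant serves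
    all subsets. *)
Lemma plunnecke_sub (A' : {fset G}) : (A' `<=` A)%fset -> A' != fset0 ->
  exists X : {fset G}, [/\ (X `<=` A')%fset, X != fset0 &
    #|` sumset X BK|%:R <= gamma * (#|` A'|%:R `^ (- e) * #|` X|%:R) :> R].
Proof.
move=> A'A A'0; have [X [XA X0 leX]] := plunnecke R B A'0 lk.
exists X; split=> //; apply: (le_trans leX); rewrite mulrA ler_wpM2r //.
rewrite ler_wpM2r ?powR_ge0 //; apply: ge0_ler_powR; rewrite ?invr_ge0 ?nnegrE ?prodr_ge0 //.
apply: ler_prod => L _; rewrite ler0n ler_nat /=.
exact/fsubset_leq_card/sumsetSl.
Qed.

(* Adjoin to [X] a set provided by Plunnecke's inequality for [A \ X] until
   [stop] holds. *)
Lemma iterate_plunnecke (F : nat -> R) (stop : pred nat) :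
  0 <= F 0%N ->
  (forall n, ~~ stop n -> (n <= m)%N -> (n < m)%N) ->
  (forall n n', ~~ stop n -> (n + n' <= m)%N ->
     (m - n)%:R `^ (- e) * n'%:R <= F (n + n')%N - F n) ->
  exists X : {fset G}, [/\ (X `<=` A)%fset, stop #|` X|%fset &
    #|` sumset X BK|%:R <= gamma * F #|` X|%fset].
Proof.
move=> F0 ltm stepF.
have gamma0 : 0 <= gamma by apply: powR_ge0.
suff iter n (X : {fset G}) : (m - #|` X| < n)%N -> (X `<=` A)%fset ->
    #|` sumset X BK|%:R <= gamma * F #|` X|%fset ->
    exists X : {fset G}, [/\ (X `<=` A)%fset, stop #|` X|%fset &
      #|` sumset X BK|%:R <= gamma * F #|` X|%fset].
  apply: (iter (m - 0).+1 fset0); rewrite ?cardfs0 ?fsub0set //.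
  by rewrite sumset0l cardfs0 mulr_ge0.
elim: n X => // n IHn X ltn XA leX.
have [stopX|goX] := boolP (stop #|` X|%fset); first by exists X.
have ltX := ltm _ goX (fsubset_leq_card XA).
have cD : #|` A `\` X|%fset = (m - #|` X|)%N by rewrite cardfsDS.
have D0 : (A `\` X)%fset != fset0 by rewrite -cardfs_gt0 cD subn_gt0.
have [Y [YD Y0 leY]] := plunnecke_sub (fsubsetDl A X) D0.
have YA : (Y `<=` A)%fset by apply: fsubset_trans YD (fsubsetDl A X).
have XYA : (X `|` Y `<=` A)%fset by rewrite fsubUset XA YA.
have disj : [disjoint X & Y]%fset.
  by rewrite fdisjoint_sym; move: YD; rewrite fsubsetD => /andP[].
have cXY : #|` X `|` Y|%fset = (#|` X| + #|` Y|)%N.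
  by apply/eqP; rewrite (leq_card_fsetU X Y).2.
have Y_gt0 : (0 < #|` Y|)%N by rewrite cardfs_gt0.
have leXY : (#|` X| + #|` Y| <= m)%N by rewrite -cXY fsubset_leq_card.
apply: (IHn (X `|` Y)%fset) => //; first by rewrite cXY; move: ltn ltX Y_gt0; clear; lia.
have : (#|` sumset (X `|` Y)%fset BK| <= #|` sumset X BK| + #|` sumset Y BK|)%N.
  apply: leq_trans (fsubset_leq_card (sumsetUl _ _ _)) _.
  exact: (leq_card_fsetU _ _).1.
rewrite -(ler_nat R) natrD => /le_trans; apply.
(* [Y] was found inside the rest of [A], which has m - |X| elements, so its bound is [gamma] times
   the left side of [stepF]. *)
rewrite cXY; have := ler_wpM2l gamma0 (stepF _ _ goX leXY).
by rewrite cD in leY; move: leX leY; rewrite mulrBr; lra.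
Qed.

End Iteration.

(** * Real powers and the constant beta *)

Lemma powR_neg_le (R : realType) (x y e : R) : 0 < x -> x <= y -> 0 <= e ->
  y `^ (- e) <= x `^ (- e).
Proof.
move=> x0 xy e0; have y0 := lt_le_trans x0 xy.
rewrite !powRN lef_pV2 ?posrE ?powR_gt0 //.
by apply: ge0_ler_powR; rewrite // nnegrE ltW.
Qed.

(* The graph of the convex function [x `^ (1 - e)] lies above its tangent at [y]. *)
Lemma powR_tangent (R : realType) (x y e : R) : 0 < x -> 0 < y -> 1 < e ->
  (y - x) * y `^ (- e) <= (e - 1)^-1 * (x `^ (1 - e) - y `^ (1 - e)).
Proof.
move=> x0 y0 e1; have e0 : 0 < e - 1 by lra.
rewrite mulrC [leRHS]mulrC ler_pdivlMr //.
have yE : y `^ (1 - e) = y * y `^ (- e).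
  by rewrite powRD; [rewrite powRr1 // ltW|rewrite (gt_eqF y0) implybT].
have r0 : 0 < x / y by rewrite divr_gt0.
have xE : x `^ (1 - e) = (x / y) `^ (1 - e) * (y * y `^ (- e)).
  by rewrite -yE -powRM ?(ltW r0) ?(ltW y0) // divfK // gt_eqF.
(* Bernoulli's inequality for a negative exponent, from exp(z) >= 1 + z and ln r <= r - 1. *)
have bern : 1 - (e - 1) * (x / y - 1) <= (x / y) `^ (1 - e).
  rewrite -[leRHS]lnK ?posrE ?powR_gt0 //; apply: le_trans (expR_ge1Dx _).
  rewrite ln_powR; have : ln (x / y) <= x / y - 1.
    have -> : x / y = 1 + (x / y - 1) by ring.
    by rewrite (le_trans (le_ln1Dx _)) //; lra.
  nra.
rewrite xE yE; have := ler_wpM2r (powR_ge0 y (- e)) (ler_wpM2l (ltW y0) bern).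
suff -> : y * (1 - (e - 1) * (x / y - 1)) = y + (e - 1) * (y - x) by lra.
by field; rewrite gt_eqF.
Qed.

(** The exponent of beta is 1 / C(k-1, l-1), so the C(k, l) denominators m contribute m^(-k/l),
    which the second factor cancels. *)
Lemma beta_powR (R : realType) (G : zmodType) (k l : nat)
    (A : {fset G}) (B : 'I_k -> {fset G}) : (0 < l <= k)%N -> A != fset0 ->
  (\prod_(L : {set 'I_k} | #|L| == l)
      (#|` sumset A (sumB B L)|%fset%:R / #|` A|%fset%:R))
    `^ ((l.-1)`!%:R * (k - l)`!%:R / (k.-1)`!%:R) *
  #|` A|%fset%:R `^ (k%:R / l%:R) = gamma R l A B.
Proof.
move=> /andP[l0 lk] A0.
have m0 : (0 : R) < #|` A|%:R by rewrite ltr0n cardfs_gt0.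
have C0 : (0 : R) < 'C(k.-1, l.-1)%:R by rewrite ltr0n bin_gt0; lia.
have lR0 : l%:R != 0 :> R by rewrite pnatr_eq0 -lt0n.
have -> : (l.-1)`!%:R * (k - l)`!%:R / (k.-1)`!%:R = 'C(k.-1, l.-1)%:R^-1 :> R.
  have := @bin_fact k.-1 l.-1; have -> : (k.-1 - l.-1 = k - l)%N by lia.
  move=> <-; last by lia.
  by rewrite !natrM; field; rewrite gt_eqF //= !pnatr_eq0 -!lt0n !fact_gt0.
have kC : k%:R * 'C(k.-1, l.-1)%:R = l%:R * 'C(k, l)%:R :> R.
  by rewrite -!natrM mul_bin_diag prednK.
have cardN : #|[pred L : {set 'I_k} | #|L| == l]| = 'C(k, l).
  by rewrite -[in RHS](card_ord k) -card_draws cardsE.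
rewrite big_split /= prodr_const cardN exprVn -powR_invn ?ltW //.
rewrite powRM ?powR_ge0 ?prodr_ge0 // -/(gamma R l A B) -mulrA -powRrM -powRD.
  have -> : - 'C(k, l)%:R / 'C(k.-1, l.-1)%:R + k%:R / l%:R = 0 :> R.
    have -> : 'C(k, l)%:R = k%:R * 'C(k.-1, l.-1)%:R / l%:R :> R.
      by rewrite kC mulrAC divff ?mul1r.
    by field; rewrite lR0 gt_eqF.
  by rewrite powRr0 mulr1.
by rewrite (gt_eqF m0) implybT.
Qed.

(** * Both parts of the theorem, from two choices of the majorant *)

Theorem theorem9 (R : realType) (G : zmodType) (k l : nat)
  (A : {fset G}) (B : 'I_k -> {fset G}) :
  (0 < l)%N -> (l < k)%N -> A != fset0 ->
  let m := #|` A|%fset in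
  let alpha := fun I : {set 'I_k} => (#|` sumset A (sumB B I)|%fset)%:R / m%:R : R in
  let beta := (\prod_(L : {set 'I_k} | #|L| == l) alpha L)
                `^ ((l.-1)`!%:R * (k - l)`!%:R / (k.-1)`!%:R) in
  let BK := sumB B [set: 'I_k] in
  let e := k%:R / l%:R : R in
  (forall a : nat, (1 <= a <= m)%N ->
     exists X : {fset G}, [/\ (X `<=` A)%fset, (a <= #|` X|%fset)%N &
       (#|` sumset X BK|%fset)%:R <=
         beta * m%:R `^ e *
         (\sum_(0 <= i < a) (m - i)%:R `^ (- e)
          + (#|` X|%fset - a)%:R * (m - a + 1)%:R `^ (- e))])
  /\
  (forall t : R, 0 <= t -> t < m%:R ->
     exists X : {fset G}, [/\ (X `<=` A)%fset, t < (#|` X|%fset)%:R &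
       (#|` sumset X BK|%fset)%:R <=
         beta * m%:R `^ e *
         (l%:R / (k - l)%:R * ((m%:R - t) `^ (1 - e) - m%:R `^ (1 - e))
          + ((#|` X|%fset)%:R - t) * (m%:R - t) `^ (- e))]).
Proof.
move=> l0 lk A0 m alpha beta BK e.
have l0k : (0 < l <= k)%N by rewrite l0 ltnW.
have l_gt0 : (0 : R) < l%:R by rewrite ltr0n.
have e1 : 1 < e by rewrite /e ltr_pdivlMr // mul1r ltr_nat.
have e0 : 0 <= e by lra.
have -> : beta * m%:R `^ e = gamma R l A B by exact: beta_powR.
split=> [a /andP[a0 am]|t t0 tm].
(* [c i] is the price of the element numbered [i] from 0. It is frozen from a-1 on: a step starting
   at n < a pays [c n] per element, and [c] is nondecreasing. *)
- pose c i := (m - minn i a.-1)%:R `^ (- e) : R.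
  have c_mono i j : (i <= j)%N -> c i <= c j.
    move=> ij; apply: powR_neg_le => //; last by rewrite ler_nat; lia.
    by rewrite ltr0n; lia.
  have [|n ||X [XA aX leX]] := @iterate_plunnecke R G k l A B l0k
      (fun N => \sum_(0 <= i < N) c i) (fun N => a <= N)%N.
  + by rewrite big_geq.
  + by rewrite -ltnNge => na _; apply: leq_trans am.
  + move=> n n'; rewrite -ltnNge => na _.
    rewrite (big_cat_nat (leq0n n) (leq_addr n' n)) /= addrAC subrr add0r.
    have -> : (m - n)%:R `^ (- e) = c n by rewrite /c (minn_idPl _) //; lia.
    rewrite mulr_natr -{1}(addKn n n') -sumr_const_nat.
    by apply: ler_sum_nat => i /andP[ni _]; exact: c_mono.
  exists X; split=> //; apply: (le_trans leX); rewrite le_eqVlt; apply/predU1P; left.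
  congr (_ * _); rewrite (big_cat_nat (leq0n a) aX) /=; congr (_ + _).
    apply: eq_big_nat => i /andP[_ ia].
    by rewrite /c (minn_idPl _) //; lia.
  rewrite mulr_natl -sumr_const_nat; apply: eq_big_nat => i /andP[ai _].
  rewrite /c (minn_idPr _); last by lia.
  by congr (_%:R `^ _); lia.
(* [F N] is the integral over [0, N] of (m - min(s, t))^(-e) ds, the continuous analogue of the sum
   in the first part. *)
- pose F N : R := if N%:R <= t
    then (e - 1)^-1 * ((m%:R - N%:R) `^ (1 - e) - m%:R `^ (1 - e))
    else (e - 1)^-1 * ((m%:R - t) `^ (1 - e) - m%:R `^ (1 - e))
         + (N%:R - t) * (m%:R - t) `^ (- e).
  have [|n ||X [XA tX leX]] := @iterate_plunnecke R G k l A B l0k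
      F (fun N => t < N%:R).
  + by rewrite /F t0 subr0 subrr mulr0.
  + by rewrite -leNgt => nt _; rewrite -(ltr_nat R); exact: le_lt_trans tm.
  + move=> n n'; rewrite -leNgt => nt nm.
    have mt0 : 0 < m%:R - t by lra.
    rewrite natrB; last by lia.
    have mn0 : 0 < m%:R - n%:R :> R by lra.
    rewrite /F nt natrD -/m -/e; case: (lerP (n%:R + n'%:R) t) => nn't.
      have x0 : 0 < m%:R - (n%:R + n'%:R) :> R by lra.
      have := powR_tangent x0 mn0 e1; nra.
    (* The step crosses [t]: the tangent bound covers the elements up to [t], and beyond it the rate
       (m - t)^(-e) is at least (m - n)^(-e). *)
    have tang := powR_tangent mt0 mn0 e1.
    have nt' : m%:R - t <= m%:R - n%:R by lra.
    have le_c := powR_neg_le mt0 nt' e0.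
    have nn'0 : 0 <= n%:R + n'%:R - t by lra.
    have := ler_wpM2l nn'0 le_c; nra.
  exists X; split=> //; apply: (le_trans leX); rewrite /F ifF; last by rewrite leNgt tX.
  suff -> : (e - 1)^-1 = l%:R / (k - l)%:R by [].
  rewrite natrB ?(ltnW lk) // /e; field.
  by rewrite subr_eq0 eqr_nat gtn_eqF // gt_eqF.
Qed.
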